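(* Let $\varepsilon\in[0,1]$ and $\delta\in[0,1/3]$. Any $(\varepsilon,\delta)$-DP (event-level) continual mechanism in the exact setting for incremental $\textsc{TopK}$ on a universe of $n$ elements and streams of length $T$ — i.e. one that outputs at each time $t$ estimates $a^t_1,\dots,a^t_n$ such that with probability at least $2/3$, for all $t\in[T]$ and all $k\in[n]$, $|a^t_k-\|f^t\|_{\mathrm{top}\text{-}k}|\le\alpha$ — must have additive error $\alpha=\Omega(\min\{T^{1/4},\sqrt n\})$.
   Context: Incremental streams over universe $[n]\cup\{\bot\}$: each update $u^t$ inserts one element of $[n]$ or is the empty element $\bot$ (no change); the frequency vector $f^t\in\mathbb N^n$ counts insertions of each element among $u^1,\dots,u^t$. For $f\in\mathbb R^n$ and $k\in[n]$, $\|f\|_{\mathrm{top}\text{-}k}=\sum_{i=1}^k|f_{\sigma(i)}|$ where $\sigma$ sorts so that $|f_{\sigma(1)}|\ge\dots\ge|f_{\sigma(n)}|$. A continual mechanism outputs after each update a value depending only on updates so far. Two streams are event-level neighboring if they differ in at most one time step; $(\varepsilon,\delta)$-DP means $\Pr[\mathcal A(u)\in S]\le e^\varepsilon\Pr[\mathcal A(v)\in S]+\delta$ for all neighbors $u,v$ and output sets $S$. *)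

(* Defs.v *)
From HB Require Import structures.
From mathcomp Require Import all_boot all_order all_algebra.
From mathcomp Require Import all_classical all_reals all_analysis.
Set Implicit Arguments. Unset Strict Implicit. Unset Printing Implicit Defensive.
Import Order.TTheory GRing.Theory Num.Theory.
Local Open Scope classical_set_scope.
Local Open Scope ring_scope.

(* A stream of length T over universe [n] ∪ {⊥}: time step t : 'I_T
   (representing time t+1) carries Some i (insertion of i) or None (⊥). *)
Definition stream (n T : nat) := 'I_T -> option 'I_n.

Definition freq (R : realType) (n T : nat) (u : stream n T) (t : 'I_T) : 'I_n -> R :=
  fun i => (#|[set s : 'I_T | (s <= t)%N && (u s == Some i)]|)%:R.

Definition topk_norm (R : realType) (n : nat) (f : 'I_n -> R) (k : nat) : R :=
  \sum_(i < k) nth 0 (sort >=%R [seq `|f j| | j <- enum 'I_n]) i.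

Definition neighboring (n T : nat) (u v : stream n T) : Prop :=
  (#|[set s : 'I_T | u s != v s]| <= 1)%N.

(* Transcript of a continual mechanism: for each time t and each k
   (k : 'I_n standing for k+1 in [n]) the output a^t_k. *)
Definition transcript (R : realType) (n T : nat) := 'I_T -> 'I_n -> R.

Definition transcript_measurable (R : realType) (n T : nat)
  (S : set (transcript R n T)) : Prop :=
  smallest (sigma_algebra setT)
    [set A | exists (t : 'I_T) (k : 'I_n) (B : set R),
        measurable B /\ A = (fun x : transcript R n T => x t k) @^-1` B] S.

(* A continual mechanism with random tape ω ∈ Ω: a ω u is the transcript
   produced on stream u.  Output at time t depends only on u^1..u^t. *)
Definition continual (R : realType) (d : measure_display) (Omega : measurableType d)
  (n T : nat) (a : Omega -> stream n T -> transcript R n T) : Prop :=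
  (forall (w : Omega) (u v : stream n T) (t : 'I_T),
      (forall s : 'I_T, (s <= t)%N -> u s = v s) -> a w u t = a w v t) /\
  (forall (u : stream n T) (t : 'I_T) (k : 'I_n),
      measurable_fun setT (fun w => a w u t k)).

Definition event_level_DP (R : realType) (d : measure_display) (Omega : measurableType d)
  (P : probability Omega R) (n T : nat) (a : Omega -> stream n T -> transcript R n T)
  (eps delta : R) : Prop :=
  forall (u v : stream n T), neighboring u v ->
  forall S : set (transcript R n T), transcript_measurable S ->
    (P [set w | a w u \in S] <= (expR eps)%:E * P [set w | a w v \in S] + delta%:E)%E.

Definition topk_accurate (R : realType) (d : measure_display) (Omega : measurableType d)
  (P : probability Omega R) (n T : nat) (a : Omega -> stream n T -> transcript R n T)
  (alpha : R) : Prop :=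
  forall u : stream n T,
    ((2 / 3 : R)%:E <= P [set w | forall (t : 'I_T) (k : 'I_n),
        (`|a w u t k - topk_norm (freq R u t) k.+1| <= alpha)%R])%E.

(* Main.v *)
Require Import Defs.
From HB Require Import structures.
From mathcomp Require Import all_boot all_order all_algebra.
From mathcomp Require Import all_classical all_reals all_analysis.
From mathcomp Require Import ring lra zify.
Import Order.TTheory GRing.Theory Num.Theory.
Local Open Scope ring_scope.

(** A secret y in {0,1}^m, with m a power of two, is inserted in the first m steps, one step
    per bit, so flipping a bit gives a neighboring stream. For a set Q in [m], inserting Q
    makes Q the top-|Q| set, whatever y is, and the top-|Q| sum reveals <1_Q, y> up to a known
    constant; inserting the complement of Q afterwards makes the insertions uniform again.
    Thus m queries cost 2m^2 steps on m elements. Take for Q the positive parts of the rows of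
    the Sylvester-Hadamard matrix: by Parseval, two secrets for which the same transcript is
    accurate differ in at most 36 alpha^2 bits, which is at most m / 100 if alpha is a small
    multiple of sqrt m.

    To contradict privacy with delta as large as 1/3, decode a transcript to some secret for
    which it is accurate, and apply the privacy inequality to the event "the transcript is
    accurate for y and its decoding agrees with y at i". Under y it has probability about 2/3
    on average over i; under y with bit i flipped it is the event that the decoding errs at i,
    so averaging over y and i its probability is at most about 1/100. This gives the false
    inequality 2/3 * 99/100 <= e / 50 + 1/3. *)

(** * Hadamard signs and Parseval *)

(** Sylvester doubling: only the lower right block changes sign, so the halves of [v] give [a + b]
    and [a - b], whose squares add up to [2 a^2 + 2 b^2]. The constant row 0 later recovers signed
    sums from sums over positive parts; the constant column 0 keeps every query set nonempty. *)
Lemma sylvester_parseval (R : comNzRingType) (l : nat) :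
  exists H : nat -> nat -> bool,
  [/\ forall j, H 0%N j = false, forall i, H i 0%N = false &
   forall v : nat -> R,
    \sum_(0 <= i < 2 ^ l) (\sum_(0 <= j < 2 ^ l) (-1) ^+ H i j * v j) ^+ 2
    = (2 ^ l)%:R * \sum_(0 <= j < 2 ^ l) v j ^+ 2].
Proof.
elim: l => [|l [H [H0 H1 HP]]].
  exists (fun _ _ => false); split=> // v.
  by rewrite expn0 !big_nat1 expr0 !mul1r.
set N := (2 ^ l)%N in HP *.
have N_gt0 : (0 < N)%N by rewrite /N expn_gt0.
exists (fun i j => H (i %% N) (j %% N) (+) ((N <= i) && (N <= j)))%N.
split=> [j|i|v].
- by rewrite mod0n H0 leqNgt N_gt0.
- by rewrite mod0n H1 andbC leqNgt N_gt0.
have -> : (2 ^ l.+1 = N + N)%N by rewrite expnS mul2n addnn.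
have split2 (F : nat -> R) : \sum_(0 <= i < N + N) F i =
    \sum_(0 <= i < N) F i + \sum_(0 <= i < N) F (i + N)%N.
  rewrite (big_cat_nat (n := N)) ?leq_addr //=; congr (_ + _).
  by rewrite -{1}[N in index_iota N]add0n big_addn addnK.
have lo i : (i < N)%N -> (i %% N = i)%N /\ (N <= i)%N = false.
  by move=> iN; rewrite modn_small // leqNgt iN.
have hi i : (i < N)%N -> ((i + N) %% N = i)%N /\ (N <= i + N)%N.
  by move=> iN; rewrite modnDr modn_small // leq_addl.
rewrite !split2.
set a := fun i => \sum_(0 <= j < N) (-1) ^+ H i j * v j.
set b := fun i => \sum_(0 <= j < N) (-1) ^+ H i j * v (j + N)%N.
under eq_big_nat => i /andP[_ /lo[ei li]].
  rewrite split2.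
  under eq_big_nat => j /andP[_ /lo[ej lj]] do rewrite ei ej li addbF.
  under [X in _ + X]eq_big_nat => j /andP[_ /hi[ej lj]] do rewrite ei ej li addbF.
  rewrite -/(a i) -/(b i); over.
under [X in _ + X]eq_big_nat => i /andP[_ /hi[ei li]].
  rewrite split2.
  under eq_big_nat => j /andP[_ /lo[ej lj]] do rewrite ei ej li lj addbF.
  under [X in _ + X]eq_big_nat => j /andP[_ /hi[ej lj]] do
    rewrite ei ej li lj addbT signrN mulNr.
  rewrite sumrN -/(a i) -/(b i); over.
rewrite -big_split /=.
under eq_bigr => i _.
  have -> : (a i + b i) ^+ 2 + (a i - b i) ^+ 2 = 2 * a i ^+ 2 + 2 * b i ^+ 2 by ring.
  over.
rewrite big_split -!mulr_sumr /= (HP v) (HP (fun j => v (j + N)%N)) natrD; ring.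
Qed.

(** * Top-k sums and frequencies of block streams *)

(** Sorting [Q] and its complement separately and concatenating gives a sorted permutation of all
    values, which is unique even with ties. *)
Lemma topk_norm_top (R : realType) (n : nat) (f : 'I_n -> R) (Q : {set 'I_n}) :
  (forall i j, i \in Q -> j \notin Q -> `|f j| <= `|f i|) ->
  topk_norm f #|Q| = \sum_(i in Q) `|f i|.
Proof.
move=> Qtop; rewrite /topk_norm.
set g := fun j => `|f j|.
set s1 := sort >=%R [seq g j | j <- enum Q].
set s2 := sort >=%R [seq g j | j <- enum (~: Q)].
have ge_tot : total (>=%R : rel R) by move=> x y; exact: le_total.
have ge_tr : transitive (>=%R : rel R) by move=> x y z /[swap]; exact: le_trans.
have sz1 : size s1 = #|Q| by rewrite size_sort size_map -cardE.
have -> : sort >=%R [seq g j | j <- enum 'I_n] = s1 ++ s2.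
  apply: (@sorted_eq _ (>=%R : rel R)) => //.
  - by move=> x y; rewrite andbC; exact: le_anti.
  - exact: sort_sorted.
  - rewrite sorted_pairwise // pairwise_cat -!sorted_pairwise // !sort_sorted //.
    rewrite !andbT; apply/allrelP => x y.
    rewrite !mem_sort => /mapP[i + ->] /mapP[j + ->].
    by rewrite !mem_enum inE => iQ jQ; exact: Qtop.
  - rewrite perm_sort perm_sym.
    apply: (@perm_trans _ ([seq g j | j <- enum Q] ++ [seq g j | j <- enum (~: Q)])).
      by apply: perm_cat; rewrite perm_sort.
    rewrite -map_cat; apply: perm_map; apply: uniq_perm.
    + rewrite cat_uniq !enum_uniq andbT /=; apply/hasPn => i.
      by rewrite !mem_enum inE.
    + exact: enum_uniq.
    + by move=> i; rewrite mem_cat !mem_enum inE orbN.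
rewrite -sz1.
under eq_bigr => i _ do rewrite nth_cat ltn_ord.
rewrite -(big_mkord xpredT (nth 0 s1)) -(big_nth 0 xpredT id).
rewrite (perm_big [seq g j | j <- enum Q]) ?perm_sort // big_map big_enum //.
Qed.

Lemma card_classical_set (T : finType) (P : pred T) :
  #|[set s | P s]%classic| = #|P|.
Proof.
by apply: eq_card => s; apply/idP/idP => [/set_mem|Ps]; last exact/mem_set.
Qed.

(** Time is cut into blocks of [m] steps, and element [p] has its own slot in each block, at
    position [p]. *)
Definition block_stream (n T m : nat) (B : nat -> nat -> bool) : stream n T :=
  fun s => if B (s %/ m)%N (s %% m)%N then insub (s %% m)%N else None.

(** Steps count from 0 and [freq] includes step [t], so [t.+1 = b * m] says that exactly [b] blocks
    are complete. *)
Lemma freq_block_stream (R : realType) (n T m b : nat) (B : nat -> nat -> bool)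
    (t : 'I_T) (i : 'I_n) :
  (0 < m)%N -> t.+1 = (b * m)%N ->
  freq R (block_stream n T m B) t i
  = (if (i < m)%N then \sum_(0 <= c < b) (B c i)%:R else 0).
Proof.
move=> m_gt0 tE.
have bmT : (b * m <= T)%N by rewrite -tE.
rewrite /freq.
set X := #|_|.
have -> : X = (\sum_(0 <= s < b * m) (B (s %/ m) (s %% m) && (s %% m == i)))%N.
  rewrite /X card_classical_set -sum1_card big_mkord.
  rewrite (big_ord_widen T (fun s => B (s %/ m) (s %% m) && (s %% m == i) : nat)%N bmT).
  rewrite big_mkcond [RHS]big_mkcond /=.
  apply: eq_bigr => s _; rewrite unfold_in /= -tE ltnS.
  have -> : (block_stream n T m B s == Some i) =
            B (s %/ m)%N (s %% m)%N && (s %% m == i)%N.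
    rewrite /block_stream; case: (B _ _) => //=.
    case: insubP => [j _ <-//|].
    by case: ((s %% m)%N =P i) => // ->; rewrite ltn_ord.
  by case: (s <= t)%N => //=; case: (B _ _ && _).
elim: b {tE bmT X} => [|b IH].
  by rewrite mul0n !big_geq // if_same.
rewrite mulSn addnC (big_cat_nat (n := (b * m)%N)) ?leq_addr //= natrD IH.
rewrite big_nat_recr //=.
have -> : (\sum_(b * m <= s < b * m + m) (B (s %/ m) (s %% m) && (s %% m == i)) =
   if i < m then B b i : nat else 0)%N.
  rewrite -{1}[(b * m)%N]add0n big_addn addnC addnK.
  under eq_big_nat => s /andP[_ sm].
    rewrite addnC divnMDl // divn_small // addn0 modnMDl modn_small //; over.
  rewrite big_mkord; case: ifP => im.
    rewrite (bigD1 (Ordinal im)) //= eqxx andbT big1 ?addn0 // => j /negPf.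
    by rewrite -val_eqE /= => ->; rewrite andbF.
  rewrite big1 // => j _; case: eqP => [ji|]; last by rewrite andbF.
  by move: im; rewrite -ji ltn_ord.
by case: ifP => _; rewrite ?addr0.
Qed.

(** * Privacy against decoding, on finite types *)

Definition hdist {m : nat} (y z : {ffun 'I_m -> bool}) : nat :=
  #|[pred i | y i != z i]|.

Definition flip {m : nat} (i : 'I_m) (y : {ffun 'I_m -> bool}) :
  {ffun 'I_m -> bool} := [ffun j => y j (+) (j == i)].

Lemma flipK {m : nat} (i : 'I_m) : involutive (@flip m i).
Proof. by move=> y; apply/ffunP => j; rewrite !ffunE addbK. Qed.

Lemma hdist_flip {m : nat} (i : 'I_m) (y z : {ffun 'I_m -> bool}) :
  (hdist z y <= (hdist z (flip i y)).+1)%N.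
Proof.
rewrite /hdist.
apply: (@leq_trans #|[predU1 i & [pred j | z j != flip i y j]]|).
  apply: subset_leq_card; apply/fintype.subsetP => j; rewrite !inE ffunE.
  by case: (j =P i) => //= _; rewrite addbF.
by rewrite cardU1 -add1n leq_add2r leq_b1.
Qed.

Lemma no_private_reconstruction (R : realType) (X : finType) (m : nat)
    (p : {ffun 'I_m -> bool} -> X -> R) (Good : {ffun 'I_m -> bool} -> pred X)
    (E delta r : R) :
  (forall y x, 0 <= p y x) -> (forall y, \sum_x p y x <= 1) ->
  (forall y z x, Good y x -> Good z x -> (hdist y z)%:R <= r) ->
  (forall y, 2 / 3 <= \sum_(x | Good y x) p y x) ->
  0 <= E -> 0 <= r <= m%:R ->
  (forall i y (F : pred X),
     \sum_(x | F x) p y x <= E * \sum_(x | F x) p (flip i y) x + delta) ->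
  (m%:R - r) * (2 / 3) <= E * (r + 1) + m%:R * delta.
Proof.
move=> p0 p1 close acc E0 /andP[r0 rm] dp.
pose y0 : {ffun 'I_m -> bool} := [ffun=> false].
(* The default [y0] is met only when [x] is good for no secret; such an [x] lies in none of the
   events [S]. *)
pose att x := odflt y0 [pick z | Good z x].
have attP y x : Good y x -> (hdist (att x) y)%:R <= r.
  move=> yx; rewrite /att; case: pickP => [z zx|/(_ y)]; last by rewrite yx.
  exact: close zx yx.
pose S y i := [pred x | Good y x && (att x i == y i)].
have sumE (F : 'I_m -> {ffun 'I_m -> bool} -> pred X) y :
    \sum_i \sum_(x | F i y x) p y x = \sum_x p y x * #|[pred i | F i y x]|%:R.
  under eq_bigr => i _ do rewrite big_mkcond.
  rewrite exchange_big /=; apply: eq_bigr => x _.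
  rewrite -sum1_card natr_sum mulr_sumr [RHS]big_mkcond /=.
  by apply: eq_bigr => i _; rewrite inE; case: (F i y x); rewrite ?mulr1.
have lower y : (m%:R - r) * (2 / 3) <= \sum_i \sum_(x | S y i x) p y x.
  rewrite (sumE (fun i y => S y i)).
  apply: (@le_trans _ _ (\sum_(x | Good y x) p y x * (m%:R - r))).
    by rewrite -mulr_suml mulrC ler_wpM2r ?subr_ge0.
  rewrite big_mkcond /=; apply: ler_sum => x _.
  case: ifP => [yx|_]; last by rewrite mulr_ge0.
  apply: ler_wpM2l => //; rewrite lerBlDr.
  apply: le_trans (lerD (lexx _) (attP _ _ yx)); rewrite -natrD ler_nat.
  rewrite -{1}(card_ord m) -(cardC [pred i | att x i == y i]) leq_add //.
have upper y : \sum_i \sum_(x | S (flip i y) i x) p y x <= r + 1.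
  rewrite (sumE (fun i y => S (flip i y) i)).
  have r10 : 0 <= r + 1 by rewrite addr_ge0.
  apply: (@le_trans _ _ (\sum_x p y x * (r + 1))); last first.
    by rewrite -mulr_suml ler_piMl.
  apply: ler_sum => x _; apply: ler_wpM2l => //.
  (* One such [i] puts [att x] within [r] of [flip i y], hence within [r + 1] of [y]; all such
     indices are errors of [att x] against [y]. *)
  have [i /= /andP[iG _]|none] := pickP [pred i | S (flip i y) i x]; last first.
    by rewrite eq_card0.
  apply: (@le_trans _ _ (hdist (att x) (flip i y)).+1%:R); last first.
    by rewrite -natr1 lerD2r attP.
  rewrite ler_nat; apply: leq_trans _ (hdist_flip i _ _).
  apply: subset_leq_card; apply/fintype.subsetP => j; rewrite !inE /S /=.
  by move=> /andP[_ /eqP ->]; rewrite ffunE eqxx addbT; case: (y j).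
have N0 : 0 < #|{ffun 'I_m -> bool}|%:R :> R.
  by rewrite ltr0n; apply/card_gt0P; exists y0.
have sumc (c : R) : #|{ffun 'I_m -> bool}|%:R * c = \sum_(y : {ffun 'I_m -> bool}) c.
  by rewrite sumr_const mulr_natl.
rewrite -(ler_pM2l N0) !sumc.
apply: (@le_trans _ _ (\sum_y \sum_i \sum_(x | S y i x) p y x)).
  by apply: ler_sum => y _; exact: lower.
apply: (@le_trans _ _ (\sum_(y : {ffun 'I_m -> bool}) \sum_(i < m)
   (E * (\sum_(x | S y i x) p (flip i y) x) + delta))).
  by apply: ler_sum => y _; apply: ler_sum => i _; exact: dp.
rewrite exchange_big /=.
under eq_bigr => i _.
  (* Replacing [y] by [flip i y] moves the flip from the distribution to the event, as [upper]
     requires. *)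
  rewrite (reindex_inj (inv_inj (flipK i))) /=.
  under eq_bigr => y _ do rewrite flipK.
  over.
rewrite exchange_big /=; apply: ler_sum => y _.
rewrite big_split /= sumr_const card_ord -mulr_sumr mulr_natl lerD2r.
by apply: ler_wpM2l => //; exact: upper.
Qed.

(** * From mechanisms to finite distributions *)

Lemma sum_fibre_measure (R : realType) (d : measure_display)
    (Omega : measurableType d) (P : {measure set Omega -> \bar R})
    (X : finType) (h : Omega -> X) (F : pred X) :
  (forall x, measurable [set w | h w = x]%classic) ->
  (\sum_(x | F x) P [set w | h w = x]%classic)%E = P [set w | F (h w)]%classic.
Proof.
move=> mh.
have step (s : seq X) : uniq s -> measurable [set w | h w \in s]%classic /\
   (\sum_(x <- s) P [set w | h w = x]%classic)%E = P [set w | h w \in s]%classic.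
  elim: s => [_|x s IH /= /andP[xs us]].
    rewrite big_nil [X in measurable X](_ : _ = set0); last by apply/seteqP; split.
    rewrite [X in P X](_ : _ = set0); last by apply/seteqP; split.
    by rewrite measure0.
  have [ms es] := IH us.
  have -> : [set w | h w \in x :: s]%classic =
     ([set w | h w = x] `|` [set w | h w \in s])%classic.
    apply/seteqP; split => w /=; rewrite inE.
      by move=> /predU1P.
    by move=> /predU1P.
  split; first exact: measurableU.
  rewrite big_cons es measureU //.
  by apply/seteqP; split => // w /= [-> /(negP xs)].
rewrite -big_enum /= (step _ (enum_uniq _)).2; congr (P _).
by apply/seteqP; split => w /=; rewrite mem_enum.
Qed.

(* Sends a transcript to the set of secrets for which it is accurate: this turns the
   mechanism into a family of distributions on a finite type. *)
Definition pattern {S : Type} {Y : finType} (G : Y -> set S) (x : S) : {set Y} :=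
  finset (fun y => `[< G y x >]).

Lemma measurable_pattern (d : measure_display) (S : measurableType d)
    (Y : finType) (G : Y -> set S) (F : pred {set Y}) :
  (forall y, measurable (G y)) -> measurable [set x | F (pattern G x)]%classic.
Proof.
move=> mG.
rewrite [X in measurable X](_ : _ = \bigcup_(W in [set W : {set Y} | F W])
   \bigcap_(y in [set: Y]) (if y \in W then G y else ~` G y))%classic.
  apply: fin_bigcup_measurable => // W _.
  apply: fin_bigcap_measurable => // y _.
  by case: ifP => _ //; exact: measurableC.
apply/seteqP; split => x /=.
  move=> Fx; exists (pattern G x) => // y _.
  by rewrite inE; case: asboolP.
move=> [W FW xW]; rewrite [pattern G x](_ : _ = W) //.
apply/setP => y; rewrite inE; have := xW y I.
by case: ifP => _ Gyx; apply/asboolP.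
Qed.

(** These structures let transcripts carry [g_sigma_algebraType], so that facts on measurable types
    apply to [transcript_measurable]. *)
HB.instance Definition _ (R : realType) (n T : nat) := gen_eqMixin (transcript R n T).
HB.instance Definition _ (R : realType) (n T : nat) := gen_choiceMixin (transcript R n T).
HB.instance Definition _ (R : realType) (n T : nat) :=
  isPointed.Build (transcript R n T) (fun _ _ => 0).

Definition coordinate_cylinders (R : realType) (n T : nat) :
    set (set (transcript R n T)) :=
  [set A | exists (t : 'I_T) (k : 'I_n) (B : set R),
     measurable B /\ A = (fun x : transcript R n T => x t k) @^-1` B]%classic.

(** The sets with measurable preimage form a sigma-algebra containing the cylinders. *)
Lemma measurable_preimage_transcript (R : realType) (d : measure_display)
    (Omega : measurableType d) (n T : nat)
    (a : Omega -> stream n T -> transcript R n T) (u : stream n T)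
    (S : set (transcript R n T)) :
  continual a -> transcript_measurable S -> measurable [set w | S (a w u)]%classic.
Proof.
move=> [_ ma] mS; apply: (mS [set A | measurable [set w | A (a w u)]]%classic).
split; first split.
- exact: measurable0.
- by move=> A mA; rewrite setTD; exact: (measurableC mA).
- by move=> F mF; exact: (bigcupT_measurable (fun i => [set w | F i (a w u)]%classic) mF).
- by move=> _ [t [k [B [mB ->]]]] /=; rewrite -[X in measurable X]setTI; exact: ma.
Qed.

Lemma topk_ball_measurable (R : realType) (n T m : nat) (t : 'I_m -> 'I_T)
    (k : 'I_m -> 'I_n) (c : 'I_m -> R) (alpha : R) :
  transcript_measurable
   [set x : transcript R n T | forall j, `|x (t j) (k j) - c j| <= alpha]%classic.
Proof.
rewrite /transcript_measurable.
change (measurable ([set x | forall j, `|x (t j) (k j) - c j| <= alpha]%classic :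
  set (g_sigma_algebraType (coordinate_cylinders R n T)))).
rewrite [X in measurable X](_ : _ = \bigcap_(j in [set: 'I_m])
  ((fun x : transcript R n T => x (t j) (k j)) @^-1`
     `[c j - alpha, c j + alpha]))%classic.
  apply: fin_bigcap_measurable => // j _; apply: sub_gen_smallest.
  by exists (t j), (k j), `[c j - alpha, c j + alpha]%classic.
by apply/seteqP; split => x /= xP j => [_|]; have := xP j;
  rewrite /= in_itv /= -ler_distl //; apply.
Qed.

(** The bound [1 + x <= expR x] at -1/2 gives [expR (1 / 2) <= 2]; then square. *)
Lemma expR_le4 (R : realType) (eps : R) : eps <= 1 -> expR eps <= 4.
Proof.
move=> eps1; apply: (@le_trans _ _ (expR 1)); first by rewrite ler_expR.
have h : 0 < expR (- (1 / 2)) :> R by exact: expR_gt0.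
have := expR_ge1Dx (- (1 / 2) : R).
have : expR (1 / 2) * expR (- (1 / 2)) = 1 :> R by rewrite -expRD subrr expR0.
have -> : expR 1 = expR (1 / 2) * expR (1 / 2) :> R by rewrite -expRD; congr expR; field.
have : 0 < expR (1 / 2) :> R by exact: expR_gt0.
move: (expR (1 / 2)) (expR (- (1 / 2))) h => x y h x0 xy hy.
have : x <= 2 by nra.
nra.
Qed.

(** Privacy passes to the laws of the patterns, since every event on patterns pulls back to a
    measurable set of transcripts; [no_private_reconstruction] then applies. *)
Lemma private_reconstruction_bound (R : realType) (d : measure_display)
    (Omega : measurableType d) (P : probability Omega R) (n T m : nat)
    (a : Omega -> stream n T -> transcript R n T) (eps delta r : R)
    (U : {ffun 'I_m -> bool} -> stream n T)
    (G : {ffun 'I_m -> bool} -> set (transcript R n T)) :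
  continual a -> event_level_DP P a eps delta ->
  (forall i y, neighboring (U y) (U (flip i y))) ->
  (forall y, transcript_measurable (G y)) ->
  (forall y, ((2 / 3)%:E <= P [set w | G y (a w (U y))]%classic)%E) ->
  (forall y z x, G y x -> G z x -> (hdist y z)%:R <= r) ->
  0 <= r <= m%:R ->
  (m%:R - r) * (2 / 3) <= expR eps * (r + 1) + m%:R * delta.
Proof.
move=> ca dp nb mG acc close r0m.
have mpat (F : pred {set {ffun 'I_m -> bool}}) :
    transcript_measurable [set x | F (pattern G x)]%classic.
  have h := @measurable_pattern _
    (g_sigma_algebraType (coordinate_cylinders R n T)) _ G F.
  by apply: h => y; exact: mG.
have mF y (F : pred {set {ffun 'I_m -> bool}}) :
    measurable [set w | F (pattern G (a w (U y)))]%classic.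
  exact: (measurable_preimage_transcript _ _ _ _ _ _ (U y) _ ca (mpat F)).
have mfib y W : measurable [set w | pattern G (a w (U y)) = W]%classic.
  rewrite [X in measurable X](_ : _ =
    [set w | pattern G (a w (U y)) == W])%classic; first exact: (mF y (pred1 W)).
  by apply/seteqP; split => w /= /eqP.
pose p y (W : {set {ffun 'I_m -> bool}}) := fine (P [set w | pattern G (a w (U y)) = W]%classic).
have pE y (F : pred {set {ffun 'I_m -> bool}}) :
    (\sum_(W | F W) p y W)%:E = P [set w | F (pattern G (a w (U y)))]%classic.
  rewrite -(@sum_fibre_measure _ _ _ P _ (fun w => pattern G (a w (U y)))) //.
  rewrite -sumEFin; apply: eq_bigr => W _.
  by rewrite /p fineK // fin_num_measure.
(* The hypothesis [close] says nothing about patterns that no transcript realizes. *)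
pose Good (y : {ffun 'I_m -> bool}) (W : {set {ffun 'I_m -> bool}}) :=
  (y \in W) && `[< exists x, pattern G x = W >].
apply: (@no_private_reconstruction R _ m p Good) => //.
- by move=> y W; rewrite /p fine_ge0.
- by move=> y; rewrite -lee_fin (pE y xpredT) probability_le1 //; exact: (mF y xpredT).
- move=> y z W /andP[yW /asboolP[x xW]] /andP[zW _].
  by apply: (close _ _ x); apply/asboolP; move: yW zW; rewrite -xW !inE.
- move=> y; rewrite -lee_fin pE; apply: (le_trans (acc y)).
  rewrite le_eqVlt; apply/orP; left; apply/eqP; congr (P _).
  apply/seteqP; split => w /=; rewrite /Good inE.
    by move=> Gyw; apply/andP; split; apply/asboolP => //; exists (a w (U y)).
  by case/andP => /asboolP.
- move=> i y F; rewrite -lee_fin EFinD EFinM !pE.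
  have := dp _ _ (nb i y) _ (mpat F).
  congr (is_true (_ <= _ * _ + _)%E); congr (P _); apply/seteqP; split => w /=.
  + by move/set_mem.
  + by move=> ?; apply/mem_set.
  + by move/set_mem.
  + by move=> ?; apply/mem_set.
Qed.

(** * The attack stream and its decoding *)

Definition bit {m : nat} (y : {ffun 'I_m -> bool}) (p : nat) : bool :=
  oapp y false (insub p).

(* Block 0 holds the secret, block 2j+1 the set Q_j = {p | ~~ H j p} of query j, and
   block 2j+2 its complement. *)
Definition attack_blocks (m : nat) (H : nat -> nat -> bool) (y : {ffun 'I_m -> bool})
    (c p : nat) : bool :=
  if c is c'.+1 then odd c' (+) ~~ H c'./2 p else bit y p.

(** Each of the [j] earlier queries, together with its complement, adds 1 to every [p]. *)
Lemma sum_attack_blocks (R : realType) (m : nat) (H : nat -> nat -> bool)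
    (y : {ffun 'I_m -> bool}) (j p : nat) :
  \sum_(0 <= c < j.*2.+2) (attack_blocks m H y c p)%:R
  = (bit y p)%:R + j%:R + (~~ H j p)%:R :> R.
Proof.
rewrite big_nat_recl //= -addrA; congr (_ + _).
elim: j => [|j IH]; first by rewrite big_nat1 add0r.
rewrite doubleS big_nat_recr //= big_nat_recr //= IH odd_double /= doubleK uphalf_double.
by rewrite negbK -natr1; case: (H j p); rewrite /=; ring.
Qed.

(** Only block 0 depends on the secret, and bit [i] is read there at step [i] alone. *)
Lemma neighboring_attack (n T m : nat) (H : nat -> nat -> bool) (i : 'I_m)
    (y : {ffun 'I_m -> bool}) :
  (m <= T)%N ->
  neighboring (block_stream n T m (attack_blocks m H y))
    (block_stream n T m (attack_blocks m H (flip i y))).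
Proof.
move=> mT; rewrite /neighboring card_classical_set.
have iT : (i < T)%N := leq_trans (ltn_ord i) mT.
apply: (@leq_trans #|pred1 (Ordinal iT)|); last by rewrite card1.
apply: subset_leq_card; apply/fintype.subsetP => s; rewrite !inE -val_eqE /=.
apply: contraR => si; rewrite /block_stream.
case E : (s %/ m)%N => [|c] //=.
have m_gt0 : (0 < m)%N := leq_ltn_trans (leq0n i) (ltn_ord i).
have sm : (s %% m)%N = s by rewrite [in RHS](divn_eq s m) E.
rewrite sm /bit; case: insubP => //= k _ ks.
have ki : (k == i) = false by apply: contraNF si => /eqP <-; rewrite -ks.
by rewrite ffunE ki addbF eqxx.
Qed.

Lemma sum_sqr_bits (R : realType) (m : nat) (y z : {ffun 'I_m -> bool}) :
  \sum_(0 <= i < m) ((bit y i)%:R - (bit z i)%:R) ^+ 2 = (hdist y z)%:R :> R.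
Proof.
rewrite big_mkord /hdist -sum1_card natr_sum [RHS]big_mkcond /=.
apply: eq_bigr => i _; rewrite /bit valK /= inE.
by case: (y i); case: (z i); rewrite /= ?subrr ?subr0 ?sub0r ?expr0n ?sqrrN ?expr1n.
Qed.

Lemma topk_lower_bound_pow2 (R : realType) (d : measure_display)
    (Omega : measurableType d) (P : probability Omega R) (n T l : nat)
    (a : Omega -> stream n T -> transcript R n T) (eps delta alpha rho : R) :
  (2 ^ l <= n)%N -> (2 * (2 ^ l) ^ 2 <= T)%N ->
  continual a -> event_level_DP P a eps delta -> topk_accurate P a alpha ->
  0 <= rho -> 6 * alpha <= rho -> rho ^+ 2 <= (2 ^ l)%:R ->
  ((2 ^ l)%:R - rho ^+ 2) * (2 / 3) <= expR eps * (rho ^+ 2 + 1) + (2 ^ l)%:R * delta.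
Proof.
have [H [H0 H1]] := sylvester_parseval R l.
have : (0 < 2 ^ l)%N by rewrite expn_gt0.
move: (2 ^ l)%N => m m_gt0 parseval mn mT ca dp acc rho0 alpha_rho rhom.
(* Query [j] is read at the last step of block 2j+1, before its complement is inserted. *)
have tP (j : 'I_m) : (((j.*2.+2 * m).-1) < T)%N.
  apply: leq_trans mT; have := ltn_ord j; nia.
pose t j := Ordinal (tP j).
have tE j : (t j).+1 = (j.*2.+2 * m)%N by rewrite /= prednK // muln_gt0.
pose Q (j : 'I_m) := finset (fun i : 'I_n => ~~ H j i && (i < m)%N).
have Q0 j : (0 < #|Q j|)%N.
  apply/card_gt0P; exists (Ordinal (leq_trans m_gt0 mn)).
  by rewrite inE /= H1 m_gt0.
have kP j : (#|Q j|.-1 < n)%N.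
  by rewrite prednK // -[X in (_ <= X)%N](card_ord n) max_card.
pose k j := Ordinal (kP j).
pose U (y : {ffun 'I_m -> bool}) := block_stream n T m (attack_blocks m H y).
pose S (y : {ffun 'I_m -> bool}) (j : 'I_m) : R := \sum_(0 <= i < m | ~~ H j i) (bit y i)%:R.
pose C (j : 'I_m) : R := \sum_(i in Q j) (j%:R + 1).
have topkE y j : topk_norm (freq R (U y) (t j)) (k j).+1 = S y j + C j.
  have fE i : freq R (U y) (t j) i =
      if (i < m)%N then (bit y i)%:R + j%:R + (~~ H j i)%:R else 0.
    by rewrite (freq_block_stream _ _ _ _ _ _ _ _ m_gt0 (tE j)) sum_attack_blocks.
  have f0 i : `|freq R (U y) (t j) i| = freq R (U y) (t j) i.
    by apply/ger0_norm; rewrite fE; case: ifP => // _; rewrite !addr_ge0.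
  rewrite /= prednK // topk_norm_top; last first.
    (* Frequencies are at least [j + 1] on [Q j], at most [j + 1] on the other elements below [m],
       and 0 from [m] on. *)
    move=> i1 i2; rewrite !f0 !fE !inE => /andP[-> ->] /=.
    have j0 : 0 <= j%:R :> R by [].
    case: (H j i2) => /=; case: ifP => // _ _;
      by case: (bit y i1); case: (bit y i2); rewrite /=; lra.
  rewrite /S big_mkord (big_ord_widen_cond n (fun i => ~~ H j i) (fun i => (bit y i)%:R) mn).
  rewrite /C [X in _ = X + _](eq_bigl (fun i => i \in Q j)); last by move=> i; rewrite inE.
  rewrite -big_split /=; apply: eq_bigr => i; rewrite inE f0 fE => /andP[-> ->].
  by rewrite addrA.
pose G (y : {ffun 'I_m -> bool}) := [set x : transcript R n T |
   forall j, `|x (t j) (k j) - (S y j + C j)| <= alpha]%classic.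
have mG y : transcript_measurable (G y) by exact: topk_ball_measurable.
apply: (@private_reconstruction_bound R _ _ P n T m a eps delta _ U G) => //.
- by move=> i y; apply: neighboring_attack; nia.
- move=> y; apply: (le_trans (acc (U y))).
  apply: le_measure; rewrite ?inE.
  + rewrite [X in measurable X](_ : _ = \bigcap_(s in [set: 'I_T])
      \bigcap_(i in [set: 'I_n]) [set w | `|a w (U y) s i -
        topk_norm (freq R (U y) s) i.+1| <= alpha])%classic.
      apply: fin_bigcap_measurable => // s _; apply: fin_bigcap_measurable => // i _.
      have := measurable_preimage_transcript _ _ _ _ _ _ (U y) _ ca
        (topk_ball_measurable R n T 1
        (fun=> s) (fun=> i) (fun=> topk_norm (freq R (U y) s) i.+1) alpha).
      congr (measurable _); apply/seteqP; split => w /=.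
        by move=> /(_ ord0).
      by move=> h _.
    apply/seteqP; split => w /= wP; first by move=> s _ i _; exact: wP.
    by move=> s i; exact: wP.
  + exact: measurable_preimage_transcript _ _ _ _ _ _ _ _ ca (mG y).
  + by move=> w /= wP j; rewrite -topkE; exact: wP.
- move=> y z x xy xz.
  pose v i : R := (bit y i)%:R - (bit z i)%:R.
  have Sd j : `|S y j - S z j| <= 2 * alpha.
    have := xy j; have := xz j; rewrite !ler_distl => /andP[? ?] /andP[? ?].
    by apply/andP; split; lra.
  (* A signed sum is twice its positive part minus the total, and row 0 supplies the total. With
     [Sd], its size is at most 4 alpha + 2 alpha, whence [6 * alpha <= rho]. *)
  have HE (j : 'I_m) : \sum_(0 <= i < m) (-1) ^+ H j i * v i =
      2 * (S y j - S z j) - (S y (Ordinal m_gt0) - S z (Ordinal m_gt0)).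
    rewrite /S -!sumrB mulr_sumr [X in _ = X - _]big_mkcond.
    rewrite [X in _ = _ - X]big_mkcond -sumrB /=; apply: eq_bigr => i _.
    by rewrite H0 /= -/(v i); case: (H j i); rewrite /= ?expr0 ?expr1; ring.
  have HB (j : 'I_m) : (\sum_(0 <= i < m) (-1) ^+ H j i * v i) ^+ 2 <= rho ^+ 2.
    rewrite -[X in X <= _]real_normK ?num_real // ler_pXn2r ?nnegrE ?normr_ge0 // HE.
    have := Sd j; have := Sd (Ordinal m_gt0).
    rewrite !ler_norml => /andP[? ?] /andP[? ?].
    by apply/andP; split; lra.
  rewrite -sum_sqr_bits -(@ler_pM2l _ m%:R) ?ltr0n // -(parseval v).
  rewrite big_mkord mulr_natl -[X in _ *+ X]card_ord -sumr_const.
  by apply: ler_sum.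
by rewrite rhom sqr_ge0.
Qed.

(** * Choice of constants *)

Theorem mainTheorem15 (R : realType) :
  exists c : R, 0 < c /\ exists M0 : R,
  forall (n T : nat), (0 < n)%N -> (0 < T)%N ->
  M0 <= Num.min (powR (T%:R) (1 / 4)) (Num.sqrt (n%:R)) ->
  forall (eps delta : R), 0 <= eps <= 1 -> 0 <= delta <= 1 / 3 ->
  forall (d : measure_display) (Omega : measurableType d) (P : probability Omega R)
         (a : Omega -> stream n T -> transcript R n T) (alpha : R),
    continual a ->
    event_level_DP P a eps delta ->
    topk_accurate P a alpha ->
    c * Num.min (powR (T%:R) (1 / 4)) (Num.sqrt (n%:R)) <= alpha.
Proof.
(* With [rho = M / 20], the condition [6 * alpha <= rho] becomes [alpha <= M / 120]. The threshold
   20 gives [M ^+ 2 >= 400], which absorbs additive constants. *)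
exists (1 / 120); split; first by lra.
exists 20 => n T n0 T0.
set M := Num.min _ _ => M20 eps delta /andP[_ eps1] /andP[_ delta3] d Omega P a alpha ca dp acc.
have M0 : 0 <= M by apply: le_trans M20.
have Mn : M ^+ 2 <= n%:R.
  rewrite -[X in _ <= X]sqr_sqrtr // ler_pXn2r ?nnegrE ?sqrtr_ge0 //.
  by rewrite /M ge_min lexx orbT.
have MT : M ^+ 4 <= T%:R.
  have -> : T%:R = (powR T%:R (1 / 4)) ^+ 4 :> R.
    by rewrite -powR_mulrn ?powR_ge0 // -powRrM mul1r mulVf // powRr1.
  by rewrite ler_pXn2r ?nnegrE ?powR_ge0 // /M ge_min lexx.
rewrite leNgt; apply/negP => alphaM.
have M2 : 400 <= M ^+ 2 by nra.
(* The aim is a power of two [m] in [(M^2/4, M^2/2]]: the upper end fits [m] into [n] and [2 m^2]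
   into [T], the lower end gives [rho^2 <= m / 100]. *)
have [N /andP[N1 N2]] : exists N : nat, N%:R <= M ^+ 2 / 2 < N.+1%:R.
  by exists (Num.truncn (M ^+ 2 / 2)); apply: truncn_itv; lra.
have N_gt0 : (0 < N)%N by rewrite -(ltr0n R); move: N2; rewrite -[N.+1%:R]natr1; lra.
have /andP[l1 l2] := trunc_log_bounds (isT : (1 < 2)%N) N_gt0.
move: (trunc_log 2 N) l1 l2 => l l1 l2.
have m1 : (2 ^ l)%:R <= M ^+ 2 / 2 :> R by apply: le_trans N1; rewrite ler_nat.
have m2 : M ^+ 2 / 4 < (2 ^ l)%:R :> R.
  have : N.+1%:R <= (2 ^ l.+1)%:R :> R by rewrite ler_nat.
  by rewrite expnS natrM; lra.
have mn : (2 ^ l <= n)%N by rewrite -(ler_nat R); lra.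
have mT : (2 * (2 ^ l) ^ 2 <= T)%N.
  rewrite -(ler_nat R) natrM natrX; apply: le_trans MT.
  have -> : M ^+ 4 = (M ^+ 2) ^+ 2 by rewrite -exprM.
  have : 0 <= (2 ^ l)%:R :> R by [].
  nra.
have := @topk_lower_bound_pow2 R d Omega P n T l a eps delta alpha (M / 20) mn mT ca dp acc.
have -> : (M / 20) ^+ 2 = M ^+ 2 / 400 by field.
move: (M ^+ 2) (2 ^ l)%:R (expR eps) (expR_le4 R eps eps1) m1 m2 M2.
move=> q m e e4 m1 m2 q400.
move=> /(_ ltac:(lra) ltac:(lra) ltac:(lra)).
move=> bound; clear - delta3 e4 m1 m2 q400 bound.
have : e * (q / 400 + 1) <= 4 * (q / 400 + 1) by apply: ler_wpM2r; [lra|exact: e4].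
have : m * delta <= m * (1 / 3) by apply: ler_wpM2l; [lra|exact: delta3].
(* The bound yields [m/3 <= q/600 + q/100 + 4 <= 13q/600], while [m/3 > q/12]. *)
lra.
Qed.
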